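(* If a semigroup $S$ is an equational domain in the language $\mathcal{L}_S$, then the equivalence relation $\sim_I$ is trivial for any ideal $I\subseteq S$.
   Context: Equational domains. For a semigroup $S$, the language $\mathcal{L}_S$ consists of the multiplication symbol together with a constant symbol for every element of $S$. An $\mathcal{L}_S$-term in the variables $x_1,\dots,x_n$ is a nonempty finite product of variables and constants from $S$. An equation over $\mathcal{L}_S$ is an equality $t=s$ of two $\mathcal{L}_S$-terms, and a system is an arbitrary set of equations in the variables $x_1,\dots,x_n$ ($n$ finite). A subset of $S^n$ is algebraic over $\mathcal{L}_S$ if it is the set of all solutions in $S^n$ of some system over $\mathcal{L}_S$. The semigroup $S$ is an equational domain (e.d.) in the language $\mathcal{L}_S$ if for all $n$ every union $Y_1\cup\dots\cup Y_m$ of finitely many ($m\ge 1$) algebraic subsets of $S^n$ is algebraic. Ideals are nonempty and two-sided. For an ideal $I$ of $S$ and $\alpha,\beta\in S$, write $\alpha\sim_I\beta$ if $\alpha x=\beta x$ and $x\alpha=x\beta$ for all $x\in I$. The relation $\sim_I$ is an equivalence relation on $S$; it is called trivial if it coincides with the equality relation on $S$, i.e. $\alpha\sim_I\beta$ implies $\alpha=\beta$. *)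

(* Defs.v *)
From mathcomp Require Import all_boot.
From mathcomp Require Import classical_sets.

Set Implicit Arguments.
Unset Strict Implicit.
Unset Printing Implicit Defensive.

Local Open Scope group_scope.
Local Open Scope classical_set_scope.

(* [semigroupType] carries a choice structure; classically every set has one,
   so this does not restrict the class of semigroups. *)

(* Bracketings are kept in the syntax; [eval] does not depend on them since
   the multiplication of [S] is associative. *)
Inductive term (S : semigroupType) (n : nat) : Type :=
| Var of 'I_n
| Const of S
| Mul of term S n & term S n.

Fixpoint eval (S : semigroupType) (n : nat) (p : n.-tuple S)
    (t : term S n) : S :=
  match t with
  | Var i => tnth p i
  | Const c => c
  | Mul t1 t2 => eval p t1 * eval p t2
  end.

(* The pair [(t, s)] stands for the equation t = s. *)
Definition equation (S : semigroupType) (n : nat) : Type :=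
  (term S n * term S n)%type.

Definition solutions (S : semigroupType) (n : nat)
    (E : set (equation S n)) : set (n.-tuple S) :=
  [set p | forall e, E e -> eval p e.1 = eval p e.2].

Definition algebraic (S : semigroupType) (n : nat)
    (Y : set (n.-tuple S)) : Prop :=
  exists E : set (equation S n), Y = solutions E.

(* The index type ['I_m.+1] makes the finite unions nonempty. *)
Definition equational_domain (S : semigroupType) : Prop :=
  forall (n m : nat) (Y : 'I_m.+1 -> set (n.-tuple S)),
    (forall i, algebraic (Y i)) -> algebraic (\bigcup_i Y i).

Definition ideal (S : semigroupType) (I : set S) : Prop :=
  I !=set0 /\ forall s x : S, I x -> I (s * x) /\ I (x * s).

Definition ideal_sim (S : semigroupType) (I : set S) (a b : S) : Prop :=
  forall x : S, I x -> a * x = b * x /\ x * a = x * b.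

Definition trivial_rel (T : Type) (R : T -> T -> Prop) : Prop :=
  forall a b : T, R a b <-> a = b.

(* Main.v *)
Require Import Defs.
From mathcomp Require Import all_boot.
From mathcomp Require Import classical_sets.

(** In an equational domain the set of all [(x, y)] with [x = a] or [y = b] is
    algebraic, so a point [(c, d)] off this cross is cut off by a single
    equation [t = s] that holds on the whole cross ([cross_closed]).  The proof
    exhibits points that no such equation can cut off.

    Let [a ~_I b] and [p, q] in [I], and compare the cross through [(a, p)] with
    the point [(b, q)].  A term in which [y] occurs takes, for [y] in [I], its
    values in [I], and then the remaining factors cannot tell [a] from [b]; a
    term in which [y] does not occur cannot tell [p] from [q].  So on the grid
    [{a, b} * {p, q}] each side of an equation depends on one coordinate only
    ([term_on_grid]), and agreement at three corners of the grid forces agreement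
    at the fourth.  Hence [a = b] or [p = q].

    If [a <> b], then [I] is therefore a single point, which is a zero of [S].
    But an equational domain with a zero [z] has no other element
    ([equational_domain_with_zero]): the point to look at is now [(z, z)], off
    the cross through [(g, g)] for any [g <> z].  The two sides of an equation
    that cuts it off cannot both contain variables, since both would be [z] there;
    and an equation between a constant and a term with variables that holds on
    the cross forces this constant to be [z]. *)

Set Implicit Arguments.
Unset Strict Implicit.
Unset Printing Implicit Defensive.

Local Open Scope group_scope.
Local Open Scope classical_set_scope.

Definition eval2 (S : semigroupType) (t : term S 2) (x y : S) : S :=
  eval [tuple x; y] t.

Lemma eval2_var (S : semigroupType) (i : 'I_2) (x y : S) :
  eval2 (Var S i) x y = if i == ord0 then x else y.
Proof. by case: i => [[|[|//]] ?]; rewrite /eval2 /= (tnth_nth x). Qed.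

(** This is how the hypothesis on [S] gets used: a point at which every
    equation valid on the cross holds belongs to the cross. *)
Lemma cross_closed (S : semigroupType) (a b c d : S) :
  equational_domain S ->
  (forall t s : term S 2,
     (forall y, eval2 t a y = eval2 s a y) ->
     (forall x, eval2 t x b = eval2 s x b) -> eval2 t c d = eval2 s c d) ->
  c = a \/ d = b.
Proof.
move=> hS closed.
pose arm (i : 'I_2) : equation S 2 :=
  (Var S i, Const 2 (if i == ord0 then a else b)).
have [|E defE] := hS 2%N 1%N (fun i => solutions [set arm i]).
  by move=> i; exists [set arm i].
have onE x y : x = a \/ y = b -> solutions E [tuple x; y].
  rewrite -defE => -[->|->].
    by exists ord0 => // e ->; apply: (eval2_var ord0).
  by exists ord_max => // e ->; apply: (eval2_var ord_max).
have : solutions E [tuple c; d].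
  by case=> t s Ets; apply: closed => [y|x]; apply: (onE _ _ _ (t, s)) => //;
    [left | right].
rewrite -defE => -[i _ /(_ _ erefl) armP].
have := etrans (esym (eval2_var i c d)) armP.
by rewrite /=; case: ifP => _; [left | right].
Qed.

Lemma eval2_ideal_sim (S : semigroupType) (I : set S) (a b y : S)
    (t : term S 2) :
  ideal I -> ideal_sim I a b -> ideal_sim I (eval2 t a y) (eval2 t b y).
Proof.
move=> [_ hI] ab; elim: t => [i|c|t IHt s IHs] x Ix.
- by rewrite !eval2_var; case: ifP => _ //; apply: ab.
- by [].
- rewrite /eval2 /= -/(eval2 t _ _) -/(eval2 s _ _) -/(eval2 t b y).
  rewrite -/(eval2 s b y) -!mulgA (IHs x Ix).1 !mulgA (IHt x Ix).2.
  split; last by have [] := IHs (x * eval2 t b y) (hI _ _ Ix).2.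
  by rewrite -!mulgA; have [] := IHt (eval2 s b y * x) (hI _ _ Ix).1.
Qed.

(** The membership in [I] is what makes the induction work: a factor in [I]
    absorbs the difference between [a] and [b] in the other factor. *)
Lemma term_on_grid (S : semigroupType) (I : set S) (a b p q : S)
    (t : term S 2) :
  ideal I -> ideal_sim I a b -> I p -> I q ->
  (forall x, eval2 t x p = eval2 t x q) \/
  (forall y, y = p \/ y = q -> I (eval2 t b y) /\ eval2 t a y = eval2 t b y).
Proof.
move=> idI ab Ip Iq; have [_ hI] := idI.
have sim y u := @eval2_ideal_sim S I a b y u idI ab.
elim: t => [i|c|t IHt s IHs]; [|by left|].
  case: (eqVneq i ord0) => [->|/negPf i1].
    by left=> x; rewrite !eval2_var.
  by right=> y yE; rewrite !eval2_var i1; case: yE => ->.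
have mulE x y : eval2 (Mul t s) x y = eval2 t x y * eval2 s x y by [].
case: IHt => [t_x|t_I]; last first.
  right=> y /t_I[Iby aby]; rewrite !mulE aby; split; first exact: (hI _ _ Iby).2.
  exact: (sim y s _ Iby).2.
case: IHs => [s_x|s_I]; first by left=> x; rewrite !mulE t_x s_x.
right=> y /s_I[Iby aby]; rewrite !mulE aby; split; first exact: (hI _ _ Iby).1.
exact: (sim y t _ Iby).1.
Qed.

Lemma ideal_sim_dichotomy (S : semigroupType) (I : set S) (a b p q : S) :
  equational_domain S -> ideal I -> ideal_sim I a b -> I p -> I q ->
  b = a \/ q = p.
Proof.
move=> hS idI ab Ip Iq; apply: cross_closed => // t s at_a at_p.
have qE : q = p \/ q = q by right.
have pE : p = p \/ p = q by left.
case: (term_on_grid t idI ab Ip Iq) => [t_x|t_y];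
  case: (term_on_grid s idI ab Ip Iq) => [s_x|s_y].
- by rewrite -t_x -s_x.
- (* walk around the grid: (b, q), (b, p), (a, p), (a, q), (b, q) *)
  by rewrite -t_x at_p -(s_y p pE).2 -at_p t_x at_a (s_y q qE).2.
- by rewrite -s_x -at_p -(t_y p pE).2 at_p s_x -at_a (t_y q qE).2.
- by rewrite -(t_y q qE).2 -(s_y q qE).2.
Qed.

(** The two cases are the terms without and with variables; a term whose value
    is [z] because of a constant [z] may fall under either. *)
Lemma term_at_zero (S : semigroupType) (z g : S) (t : term S 2) :
  (forall x, z * x = z /\ x * z = z) ->
  (forall x y x' y', eval2 t x y = eval2 t x' y') \/
  (eval2 t z z = z /\ (eval2 t z g = z \/ eval2 t g z = z)).
Proof.
move=> zero.
have zl x : z * x = z by have [] := zero x.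
have zr x : x * z = z by have [] := zero x.
elim: t => [i|c|t IHt s IHs]; [|by left|].
  by right; rewrite !eval2_var; case: ifP => _; split=> //; [left | right].
have mulE x y : eval2 (Mul t s) x y = eval2 t x y * eval2 s x y by [].
case: IHt => [t_c|[tz tg]]; last first.
  by right; rewrite !mulE tz zl; split=> //; case: tg => ->; rewrite zl;
    [left | right].
case: IHs => [s_c|[sz sg]].
  by left=> x y x' y'; rewrite !mulE (t_c x y x' y') (s_c x y x' y').
by right; rewrite !mulE sz zr; split=> //; case: sg => ->; rewrite zr;
  [left | right].
Qed.

Lemma equational_domain_with_zero (S : semigroupType) (z g : S) :
  equational_domain S -> (forall x, z * x = z /\ x * z = z) -> z = g.
Proof.
move=> hS zero; suff [] : z = g \/ z = g by [].
apply: cross_closed => // t s at_g g_at.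
case: (term_at_zero g t zero) => [t_c|[tz tg]];
  case: (term_at_zero g s zero) => [s_c|[sz sg]].
- by rewrite (t_c z z g z) at_g; apply: s_c.
- rewrite sz; case: sg => sg.
    by rewrite (t_c z z z g) g_at.
  by rewrite (t_c z z g z) at_g.
- rewrite tz; case: tg => tg.
    by rewrite (s_c z z z g) -g_at.
  by rewrite (s_c z z g z) -at_g.
- by rewrite tz sz.
Qed.

Theorem theorem5p3 (S : semigroupType) (hS : equational_domain S)
    (I : set S) (hI : ideal I) : trivial_rel (ideal_sim I).
Proof.
move=> a b; split=> [ab|-> //].
have [[z Iz] idI] := hI.
case: (eqVneq a b) => // /eqP neq_ab.
have I1 q : I q -> q = z.
  by case/(ideal_sim_dichotomy hS hI ab Iz) => // ba; case: neq_ab.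
have zero x : z * x = z /\ x * z = z.
  by have [? ?] := idI x z Iz; split; apply: I1.
by rewrite -(equational_domain_with_zero a hS zero);
  apply: equational_domain_with_zero.
Qed.
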